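(* Let $\gamma(s)$ be a unit speed planar curve in $\mathbb{E}^2$. Then the canonical vector field of $\gamma$ is incompressible if and only if, up to rigid rotations of $\mathbb{E}^2$ about the origin, $\gamma$ is an open portion of a curve of one of the following two types: (a) a circle centered at the origin; (b) the curve defined by $$\gamma(s)=\frac{2}{c^2}\Big(\cos(c\sqrt{s})+c\sqrt{s}\,\sin(c\sqrt{s}),\ \sin(c\sqrt{s})-c\sqrt{s}\,\cos(c\sqrt{s})\Big),\qquad s>0,$$ for some nonzero real number $c$.
   Context: Curves are smooth and defined on open intervals. The position vector field $\mathbf{x}$ of $\gamma$ (relative to the origin of $\mathbb{E}^2$) decomposes as $\mathbf{x}=\mathbf{x}^T+\mathbf{x}^N$ into components tangent and normal to the curve; $\mathbf{x}^T$ is called the canonical vector field of $\gamma$. A vector field on a Riemannian manifold (here the curve regarded as a 1-dimensional Riemannian manifold via arclength) is incompressible if its divergence vanishes at all points. ''Open portion of a curve'' means that, after changing the arclength parameter by a translation and possibly a reversal $s\mapsto -s$, $\gamma$ is the restriction to an open interval of a unit speed parametrization of the listed curve. *)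

(* Defs.v *)
From Stdlib Require Import Reals Lra.
From Coquelicot Require Import Coquelicot.
Open Scope R_scope.

Definition plane := (R * R)%type.

Definition inner (p q : plane) : R := fst p * fst q + snd p * snd q.

Definition enorm (p : plane) : R := sqrt (inner p p).

Definition smul (k : R) (p : plane) : plane := (k * fst p, k * snd p).

Definition rotation (theta : R) (p : plane) : plane :=
  (cos theta * fst p - sin theta * snd p,
   sin theta * fst p + cos theta * snd p).

(* The open interval (a, b), possibly unbounded. *)
Definition in_itv (a b : Rbar) (s : R) : Prop :=
  Rbar_lt a (Finite s) /\ Rbar_lt (Finite s) b.

(* Curves are total functions of which only the values on (a, b) matter. *)
Definition smooth_on (a b : Rbar) (g : R -> plane) : Prop :=
  forall (n : nat) (s : R), in_itv a b s ->
    ex_derive_n (fun t => fst (g t)) n s /\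
    ex_derive_n (fun t => snd (g t)) n s.

Definition velocity (g : R -> plane) (s : R) : plane :=
  (Derive (fun t => fst (g t)) s, Derive (fun t => snd (g t)) s).

Definition unit_speed_on (a b : Rbar) (g : R -> plane) : Prop :=
  forall s : R, in_itv a b s -> enorm (velocity g s) = 1.

(* Orthogonal projection of [v] onto the tangent line of [g] at [s]. *)
Definition tangent_part (g : R -> plane) (s : R) (v : plane) : plane :=
  smul (inner v (velocity g s) / inner (velocity g s) (velocity g s))
       (velocity g s).

(* The position vector at parameter [s] is [g s] itself. *)
Definition canonical_field (g : R -> plane) (s : R) : plane :=
  tangent_part g s (g s).

(* For a unit speed curve the arclength [s] is a coordinate in which the
   induced metric is ds^2, and d/ds is represented by [velocity g].  A tangent
   field V = f d/ds has f = <V, g'>, and its divergence is df/ds. *)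
Definition divergence (g V : R -> plane) (s : R) : R :=
  Derive (fun t => inner (V t) (velocity g t)) s.

Definition incompressible_on (a b : Rbar) (g V : R -> plane) : Prop :=
  forall s : R, in_itv a b s -> divergence g V s = 0.

(* After the change of parameter s |-> eps * s + s0, the curve [g] on (a, b) is
   the restriction to an open interval of [h] on (a', b'). *)
Definition open_portion (a b : Rbar) (g : R -> plane)
    (a' b' : Rbar) (h : R -> plane) : Prop :=
  exists eps s0 : R, (eps = 1 \/ eps = -1) /\
    forall s : R, in_itv a b s ->
      in_itv a' b' (eps * s + s0) /\ g s = h (eps * s + s0).

Definition centered_circle (r : R) (p : plane) : Prop := enorm p = r.

Definition unit_speed_parametrization (a b : Rbar) (h : R -> plane)
    (C : plane -> Prop) : Prop :=
  Rbar_lt a b /\ smooth_on a b h /\ unit_speed_on a b h /\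
  forall p : plane, C p <-> exists s : R, in_itv a b s /\ h s = p.

Definition portion_of_centered_circle (a b : Rbar) (g : R -> plane) : Prop :=
  exists r : R, 0 < r /\
  exists (a' b' : Rbar) (h : R -> plane),
    unit_speed_parametrization a' b' h (centered_circle r) /\
    open_portion a b g a' b' h.

Definition spiral (c s : R) : plane :=
  smul (2 / c ^ 2)
    (cos (c * sqrt s) + c * sqrt s * sin (c * sqrt s),
     sin (c * sqrt s) - c * sqrt s * cos (c * sqrt s)).

(* [spiral c] already has unit speed on (0, +oo): its velocity is
   (cos (c * sqrt s), sin (c * sqrt s)). *)
Definition portion_of_spiral (a b : Rbar) (g : R -> plane) : Prop :=
  exists c : R, c <> 0 /\ open_portion a b g (Finite 0) p_infty (spiral c).

(* Main.v *)
(** Along a unit speed curve put [f = <g, g'>] and [h = g x g'].  The divergence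
    of the canonical field is [f'], and [2 f = (|g|^2)'], so incompressibility
    means that [|g|^2 = 2 k s + m] is affine; then [f = k] and
    [h^2 = |g|^2 - k^2 = 2 k s + m - k^2].  On an open interval [h] cannot vanish,
    hence has constant sign, so [|g|^2], [f] and [h] agree with those of a
    centered circle ([k = 0]) or of a spiral ([k <> 0]).  These three quantities
    determine the logarithmic derivative [g'/g = (f + i h) / |g|^2] and therefore
    [g] up to a rotation. *)

Require Import Defs.
From Stdlib Require Import Reals Ranalysis5 Lra.
From Coquelicot Require Import Coquelicot.
Open Scope R_scope.

(** * Plane vectors: cross product, derivatives, norms and angles *)

Definition cross (p q : plane) : R := fst p * snd q - snd p * fst q.

(** A relational form of [velocity] that also asserts differentiability, which the total function
    [Derive] does not. *)
Definition is_velocity (g : R -> plane) (s : R) (v : plane) : Prop :=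
  is_derive (fun t => fst (g t)) s (fst v) /\
  is_derive (fun t => snd (g t)) s (snd v).

Lemma is_derive_sum_of_squares (x y : R -> R) (s dx dy : R) :
  is_derive x s dx -> is_derive y s dy ->
  is_derive (fun t => x t * x t + y t * y t) s (2 * (x s * dx + y s * dy)).
Proof.
  intros H1 H2. auto_derive.
  - repeat split; eexists; eassumption.
  - rewrite (is_derive_unique (fun t : R => x t) s _ H1), (is_derive_unique (fun t : R => y t) s _ H2); ring.
Qed.

Lemma is_derive_inner_self (g : R -> plane) (s : R) (v : plane) :
  is_velocity g s v ->
  is_derive (fun t => inner (g t) (g t)) s (2 * inner (g s) v).
Proof.
  intros [H1 H2]. exact (is_derive_sum_of_squares _ _ s _ _ H1 H2).
Qed.

Lemma inner_rotation (theta : R) (p : plane) :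
  inner (rotation theta p) (rotation theta p) = inner p p.
Proof.
  unfold inner, rotation; simpl.
  generalize (sin2_cos2 theta); unfold Rsqr; intros H.
  transitivity ((sin theta * sin theta + cos theta * cos theta) *
                (fst p * fst p + snd p * snd p)); [ring | rewrite H; ring].
Qed.

Lemma enorm_eq_iff (p : plane) (r : R) :
  0 <= r -> (enorm p = r <-> inner p p = r * r).
Proof.
  intros Hr; unfold enorm.
  assert (Hp : 0 <= inner p p) by (unfold inner; nra).
  split; intros H.
  - rewrite <- H; symmetry; apply sqrt_sqrt; exact Hp.
  - rewrite H; apply sqrt_square; exact Hr.
Qed.

(** [acos x] gives the angle up to sign, and the sign of [y] chooses between the two candidates. *)
Lemma exists_angle (x y : R) :
  x * x + y * y = 1 -> exists theta : R, cos theta = x /\ sin theta = y.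
Proof.
  intros H.
  assert (Hx : -1 <= x <= 1) by nra.
  assert (Hs : sqrt (1 - x²) = Rabs y).
  { replace (1 - x²) with (y²) by (unfold Rsqr; lra). apply sqrt_Rsqr_abs. }
  destruct (Rle_dec 0 y) as [Hy | Hy].
  - exists (acos x). rewrite cos_acos by exact Hx. rewrite sin_acos by exact Hx.
    rewrite Hs, Rabs_right; lra.
  - exists (- acos x).
    rewrite cos_neg, sin_neg, cos_acos by exact Hx. rewrite sin_acos by exact Hx.
    rewrite Hs, Rabs_left; lra.
Qed.

(** * Functions on open intervals: constancy and constant sign *)

Lemma locally_in_itv (a b : Rbar) (s : R) :
  in_itv a b s -> locally s (in_itv a b).
Proof.
  intros [Ha Hb]. unfold in_itv. apply filter_and.
  - exact (open_Rbar_gt' (Finite s) a Ha).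
  - exact (open_Rbar_lt' (Finite s) b Hb).
Qed.

Lemma in_itv_convex (a b : Rbar) (s t u : R) :
  in_itv a b s -> in_itv a b t -> Rmin s t <= u <= Rmax s t -> in_itv a b u.
Proof.
  unfold in_itv, Rmin, Rmax.
  intros [H1 H2] [H3 H4] Hu.
  destruct a; destruct b; destruct (Rle_dec s t); simpl in *; split; lra.
Qed.

Lemma in_itv_nonempty (a b : Rbar) : Rbar_lt a b -> exists s : R, in_itv a b s.
Proof.
  unfold in_itv; destruct a as [a| |]; destruct b as [b| |]; simpl; intros H;
    try contradiction.
  - exists ((a + b) / 2); lra.
  - exists (a + 1); lra.
  - exists (b - 1); lra.
  - exists 0; tauto.
Qed.

Lemma constant_on_itv (a b : Rbar) (F : R -> R) :
  (forall s : R, in_itv a b s -> is_derive F s 0) ->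
  forall s t : R, in_itv a b s -> in_itv a b t -> F s = F t.
Proof.
  intros HF s t Hs Ht.
  destruct (MVT_gen F s t (fun _ => 0)) as [u [_ Hu]].
  - intros u Hu; apply HF, (in_itv_convex a b s t u Hs Ht); lra.
  - intros u Hu. apply continuity_pt_filterlim, (ex_derive_continuous F).
    exists 0; apply HF, (in_itv_convex a b s t u Hs Ht Hu).
  - lra.
Qed.

(** Intermediate value theorem: a change of sign would force a zero. The sign is returned as a real
    [sigma] because it later serves as the orientation of the model curve. *)
Lemma constant_sign_on_itv (a b : Rbar) (F : R -> R) :
  Rbar_lt a b ->
  (forall s : R, in_itv a b s -> continuous F s) ->
  (forall s : R, in_itv a b s -> F s <> 0) ->
  exists sigma : R, (sigma = 1 \/ sigma = -1) /\
    forall s : R, in_itv a b s -> 0 < sigma * F s.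
Proof.
  intros Hab Hc Hn.
  assert (Hpt : forall s, in_itv a b s -> continuity_pt F s)
    by (intros s Hs; apply continuity_pt_filterlim, Hc, Hs).
  assert (Hno : forall s t, in_itv a b s -> in_itv a b t ->
            F s < 0 -> 0 < F t -> False).
  { intros s t Hs Ht Hns Hpt'.
    destruct (Rtotal_order s t) as [Hst | [Hst | Hst]].
    - destruct (IVT_interv F s t) as [u [Hu Hu0]]; try assumption.
      + intros u Hu; apply Hpt, (in_itv_convex a b s t u Hs Ht).
        rewrite Rmin_left, Rmax_right; lra.
      + apply (Hn u); [|exact Hu0]. apply (in_itv_convex a b s t u Hs Ht).
        rewrite Rmin_left, Rmax_right; lra.
    - subst t; lra.
    (* [IVT_interv] expects a negative value at the left end, so [F] is negated when the positive
       value comes first. *)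
    - destruct (IVT_interv (fun u => - F u) t s) as [u [Hu Hu0]]; try lra.
      + intros u Hu.
        apply (continuity_pt_opp F), Hpt, (in_itv_convex a b s t u Hs Ht).
        rewrite Rmin_right, Rmax_left; lra.
      + apply (Hn u); [|lra]. apply (in_itv_convex a b s t u Hs Ht).
        rewrite Rmin_right, Rmax_left; lra. }
  destruct (in_itv_nonempty a b Hab) as [s0 Hs0].
  destruct (Rtotal_order (F s0) 0) as [H0 | [H0 | H0]].
  - exists (-1); split; [now right|]. intros s Hs.
    destruct (Rtotal_order (F s) 0) as [H | [H | H]]; [lra | now elim (Hn s Hs) |].
    elim (Hno s0 s); assumption.
  - now elim (Hn s0 Hs0).
  - exists 1; split; [now left|]. intros s Hs.
    destruct (Rtotal_order (F s) 0) as [H | [H | H]]; [| now elim (Hn s Hs) | lra].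
    elim (Hno s s0); assumption.
Qed.

(** * Rigidity: the logarithmic derivative determines a curve up to rotation *)

(** Write [p = x + i y] and [q = u + i v]. Both solve [z' = (f + i h) z / N], and the two functions
    are the real and imaginary parts of [q / p], whose derivative [(q' p - q p') / p^2] vanishes. *)
Lemma is_derive_conj_quotient (x y u v : R -> R) (f h s : R) :
  let N := x s * x s + y s * y s in
  N <> 0 ->
  is_derive x s ((f * x s - h * y s) / N) ->
  is_derive y s ((f * y s + h * x s) / N) ->
  is_derive u s ((f * u s - h * v s) / N) ->
  is_derive v s ((f * v s + h * u s) / N) ->
  is_derive (fun t => (x t * u t + y t * v t) / (x t * x t + y t * y t)) s 0 /\
  is_derive (fun t => (x t * v t - y t * u t) / (x t * x t + y t * y t)) s 0.
Proof.
  intros N HN Dx Dy Du Dv; unfold N in *.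
  split; (auto_derive; [repeat split; try (eexists; eassumption); exact HN|]);
    rewrite (is_derive_unique (fun t : R => x t) _ _ Dx), (is_derive_unique (fun t : R => y t) _ _ Dy),
      (is_derive_unique (fun t : R => u t) _ _ Du), (is_derive_unique (fun t : R => v t) _ _ Dv);
    field; exact HN.
Qed.

(* In complex notation the hypotheses say [p'/p = q'/q], so that [q/p] is a
   constant of modulus one. *)
Lemma equal_up_to_rotation (a b : Rbar) (p q p' q' : R -> plane) :
  Rbar_lt a b ->
  (forall s, in_itv a b s -> is_velocity p s (p' s)) ->
  (forall s, in_itv a b s -> is_velocity q s (q' s)) ->
  (forall s, in_itv a b s -> inner (p s) (p s) <> 0) ->
  (forall s, in_itv a b s -> inner (p s) (p s) = inner (q s) (q s)) ->
  (forall s, in_itv a b s -> inner (p s) (p' s) = inner (q s) (q' s)) ->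
  (forall s, in_itv a b s -> cross (p s) (p' s) = cross (q s) (q' s)) ->
  exists theta : R, forall s, in_itv a b s -> rotation theta (p s) = q s.
Proof.
  intros Hab Hp Hq Hn HN Hf Hh.
  set (A := fun s => (fst (p s) * fst (q s) + snd (p s) * snd (q s)) /
                     (fst (p s) * fst (p s) + snd (p s) * snd (p s))).
  set (B := fun s => (fst (p s) * snd (q s) - snd (p s) * fst (q s)) /
                     (fst (p s) * fst (p s) + snd (p s) * snd (p s))).
  assert (HAB : forall s, in_itv a b s -> is_derive A s 0 /\ is_derive B s 0).
  { intros s Hs. unfold A, B.
    destruct (Hp s Hs) as [Dp1 Dp2]. destruct (Hq s Hs) as [Dq1 Dq2].
    specialize (Hn s Hs). specialize (HN s Hs).
    specialize (Hf s Hs). specialize (Hh s Hs).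
    unfold inner, cross in *.
    (* A vector is recovered from its inner and cross products with a nonzero position [p]: it
       equals [(f + i h) p / |p|^2]. *)
    assert (Hsolve : forall x y u v N : R, N <> 0 -> N = x * x + y * y ->
              u = ((x * u + y * v) * x - (x * v - y * u) * y) / N /\
              v = ((x * u + y * v) * y + (x * v - y * u) * x) / N).
    { intros x y u v N HN0 HNe. subst N. split; field; exact HN0. }
    pose proof (Hsolve _ _ (fst (p' s)) (snd (p' s)) _ Hn eq_refl) as [P1 P2].
    pose proof (Hsolve _ _ (fst (q' s)) (snd (q' s)) _ Hn HN) as [Q1 Q2].
    rewrite <- Hf, <- Hh in Q1, Q2.
    rewrite P1 in Dp1; rewrite P2 in Dp2; rewrite Q1 in Dq1; rewrite Q2 in Dq2.
    exact (is_derive_conj_quotient _ _ _ _ _ _ s Hn Dp1 Dp2 Dq1 Dq2). }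
  destruct (in_itv_nonempty a b Hab) as [s0 Hs0].
  (* [A + i B = q / p] has modulus one since [|p| = |q|]; its argument at [s0] is the rotation
     angle. *)
  destruct (exists_angle (A s0) (B s0)) as [theta [Hc Hs']].
  { unfold A, B. specialize (Hn s0 Hs0). specialize (HN s0 Hs0).
    unfold inner in *.
    match goal with |- ?l = 1 =>
      replace l with
        ((fst (q s0) * fst (q s0) + snd (q s0) * snd (q s0)) /
         (fst (p s0) * fst (p s0) + snd (p s0) * snd (p s0)))
        by (field; exact Hn)
    end.
    rewrite <- HN; field; exact Hn. }
  exists theta. intros s Hs. unfold rotation.
  rewrite Hc, Hs', (constant_on_itv a b A (fun t Ht => proj1 (HAB t Ht)) s0 s Hs0 Hs),
    (constant_on_itv a b B (fun t Ht => proj2 (HAB t Ht)) s0 s Hs0 Hs).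
  unfold A, B. specialize (Hn s Hs). unfold inner in Hn.
  rewrite (surjective_pairing (q s)); simpl. f_equal; field; exact Hn.
Qed.

(** * The centered circle parametrized by arclength *)

Definition circle (r t : R) : plane := (r * cos (t / r), r * sin (t / r)).

Lemma is_velocity_circle (r eps s : R) :
  r <> 0 ->
  is_velocity (fun s => circle r (eps * s)) s
    (smul eps (- sin (eps * s / r), cos (eps * s / r))).
Proof.
  intros Hr; split; unfold circle; simpl; auto_derive; try exact I;
    unfold Rdiv; field; exact Hr.
Qed.

(** The span of [cos (w t)] and [sin (w t)] is closed under differentiation; smoothness of the
    circle at every order follows. *)
Lemma Derive_n_trig (w : R) (n : nat) :
  forall A B : R, exists A' B' : R, forall t : R,
    Derive_n (fun t => A * cos (w * t) + B * sin (w * t)) n t =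
    A' * cos (w * t) + B' * sin (w * t).
Proof.
  induction n as [|n IH]; intros A B.
  - now exists A, B.
  - destruct (IH A B) as [A' [B' H]]. exists (w * B'), (- w * A'). intros t.
    simpl. rewrite (Derive_ext _ _ _ H). apply is_derive_unique.
    auto_derive; [exact I | ring].
Qed.

Lemma ex_derive_n_trig (w A B : R) (n : nat) (t : R) :
  ex_derive_n (fun t => A * cos (w * t) + B * sin (w * t)) n t.
Proof.
  destruct n as [|n]; [exact I|]. simpl.
  destruct (Derive_n_trig w n A B) as [A' [B' H]].
  apply ex_derive_ext with (1 := fun t => eq_sym (H t)).
  auto_derive; exact I.
Qed.

(** The whole line is used as parameter interval, winding around the circle infinitely often, so
    that arcs of any length are restrictions of this one curve. *)
Lemma circle_parametrization (r : R) :
  0 < r -> unit_speed_parametrization m_infty p_infty (circle r) (centered_circle r).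
Proof.
  intros Hr. split; [exact I|]. split; [|split].
  - intros n s _. unfold circle; simpl. split.
    + apply ex_derive_n_ext with (2 := ex_derive_n_trig (/ r) r 0 n s).
      intros t; unfold Rdiv; rewrite (Rmult_comm t); ring.
    + apply ex_derive_n_ext with (2 := ex_derive_n_trig (/ r) 0 r n s).
      intros t; unfold Rdiv; rewrite (Rmult_comm t); ring.
  - intros s _. apply enorm_eq_iff; [lra|]. unfold velocity.
    assert (H1 : Derive (fun t => fst (circle r t)) s = - sin (s / r)).
    { apply is_derive_unique; unfold circle; simpl; auto_derive; [exact I|].
      unfold Rdiv; field; lra. }
    assert (H2 : Derive (fun t => snd (circle r t)) s = cos (s / r)).
    { apply is_derive_unique; unfold circle; simpl; auto_derive; [exact I|].
      unfold Rdiv; field; lra. }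
    rewrite H1, H2; unfold inner; simpl.
    generalize (sin2_cos2 (s / r)); unfold Rsqr; lra.
  - intros [x y]. unfold centered_circle. rewrite enorm_eq_iff by lra.
    unfold inner, circle; simpl. split.
    (* Scaling to the unit circle gives the angle [t]; the arclength parameter is then [r * t]. *)
    + intros H. destruct (exists_angle (x / r) (y / r)) as [t [Hc Hs]].
      { replace (x / r * (x / r) + y / r * (y / r))
          with ((x * x + y * y) / (r * r)) by (field; lra).
        rewrite H; field; lra. }
      exists (r * t). split; [now split|].
      replace (r * t / r) with t by (field; lra). rewrite Hc, Hs.
      f_equal; field; lra.
    + intros [t [_ H]]. injection H as <- <-.
      generalize (sin2_cos2 (t / r)); unfold Rsqr; nra.
Qed.

(** * The spiral: norm, velocity and their products *)

(** With [phi = c sqrt t] the spiral is [(2 / c^2) e^(i phi) (1 - i phi)], an involute of a circle,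
    so its squared norm is [(4 / c^4) (1 + phi^2)]. *)
Lemma inner_spiral (c t : R) :
  c <> 0 -> 0 <= t ->
  inner (spiral c t) (spiral c t) = 4 / c ^ 4 + 4 / c ^ 2 * t.
Proof.
  intros Hc Ht. unfold inner, spiral; simpl.
  generalize (sin2_cos2 (c * sqrt t)); unfold Rsqr; intros H.
  set (S := sin (c * sqrt t)) in *. set (C := cos (c * sqrt t)) in *.
  transitivity (4 / c ^ 4 * ((S * S + C * C) * (1 + c ^ 2 * (sqrt t * sqrt t))));
    [field; exact Hc|].
  rewrite H, sqrt_sqrt by exact Ht. field; exact Hc.
Qed.

(** The derivative of [e^(i phi) (1 - i phi)] is [phi phi' e^(i phi)], and [phi phi' = c^2 / 2]
    because [phi^2 = c^2 t]. Strict positivity keeps the argument of [sqrt] where it is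
    differentiable. *)
Lemma is_velocity_spiral (c eps s0 s : R) :
  c <> 0 -> 0 < eps * s + s0 ->
  is_velocity (fun s => spiral c (eps * s + s0)) s
    (smul eps (cos (c * sqrt (eps * s + s0)), sin (c * sqrt (eps * s + s0)))).
Proof.
  intros Hc Ht. pose proof (sqrt_lt_R0 _ Ht).
  split; unfold spiral; simpl; (auto_derive; [tauto|]);
    field; split; lra.
Qed.

(** Both values are read off from [conj(p) p' = (2 / c^2) (1 + i phi)]. The inner product is always
    positive, while the cross product takes the sign of [c] for [t > 0]. *)
Lemma spiral_inner_velocity (c t : R) :
  c <> 0 ->
  inner (spiral c t) (cos (c * sqrt t), sin (c * sqrt t)) = 2 / c ^ 2 /\
  cross (spiral c t) (cos (c * sqrt t), sin (c * sqrt t)) = 2 / c * sqrt t.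
Proof.
  intros Hc. unfold inner, cross, spiral; simpl.
  generalize (sin2_cos2 (c * sqrt t)); unfold Rsqr; intros H.
  set (S := sin (c * sqrt t)) in *. set (C := cos (c * sqrt t)) in *.
  split.
  - transitivity (2 / c ^ 2 * (S * S + C * C)); [field; exact Hc|].
    rewrite H; field; exact Hc.
  - transitivity (2 / c * sqrt t * (S * S + C * C)); [field; exact Hc|].
    rewrite H; field; exact Hc.
Qed.

(** * The divergence of the canonical field and affine squared norms *)

Lemma smooth_on_is_velocity (a b : Rbar) (g : R -> plane) (s : R) :
  smooth_on a b g -> in_itv a b s -> is_velocity g s (velocity g s).
Proof.
  intros Hg Hs. destruct (Hg 1%nat s Hs) as [H1 H2].
  split; apply Derive_correct; assumption.
Qed.

Lemma ex_derive_inner_velocity (a b : Rbar) (g : R -> plane) (s : R) :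
  smooth_on a b g -> in_itv a b s ->
  ex_derive (fun t => inner (g t) (velocity g t)) s.
Proof.
  intros Hg Hs. destruct (Hg 1%nat s Hs) as [H1 H2].
  destruct (Hg 2%nat s Hs) as [H3 H4].
  unfold inner, velocity.
  apply (ex_derive_plus (V := R_NormedModule)); apply ex_derive_mult; assumption.
Qed.

Lemma unit_speed_inner (a b : Rbar) (g : R -> plane) (s : R) :
  unit_speed_on a b g -> in_itv a b s ->
  inner (velocity g s) (velocity g s) = 1.
Proof.
  intros Hg Hs. rewrite (proj1 (enorm_eq_iff _ 1 Rle_0_1) (Hg s Hs)). ring.
Qed.

(** Projecting onto the tangent line does not change the inner product with the tangent vector. Unit
    speed holds only on the interval, so the two differentiated functions are compared locally. *)
Lemma divergence_canonical_field (a b : Rbar) (g : R -> plane) (s : R) :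
  unit_speed_on a b g -> in_itv a b s ->
  divergence g (canonical_field g) s =
  Derive (fun t => inner (g t) (velocity g t)) s.
Proof.
  intros Hg Hs. unfold divergence. apply Derive_ext_loc.
  apply (filter_imp (in_itv a b)); [|exact (locally_in_itv a b s Hs)].
  intros t Ht. pose proof (unit_speed_inner a b g t Hg Ht) as Hu.
  unfold canonical_field, tangent_part. rewrite Hu.
  unfold smul, inner in *; cbn [fst snd].
  match goal with |- ?l = ?r =>
    transitivity (r * (fst (velocity g t) * fst (velocity g t) +
                       snd (velocity g t) * snd (velocity g t))); [field|]
  end.
  rewrite Hu; ring.
Qed.

(* The canonical field is [f d/ds] with [2 f] the derivative of [|g|^2]. *)
Lemma incompressible_of_affine_norm (a b : Rbar) (g : R -> plane) (A B : R) :
  smooth_on a b g -> unit_speed_on a b g ->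
  (forall s, in_itv a b s -> inner (g s) (g s) = A + B * s) ->
  incompressible_on a b g (canonical_field g).
Proof.
  intros Hg Hu HN s Hs. rewrite (divergence_canonical_field a b g s Hu Hs).
  rewrite (Derive_ext_loc _ (fun _ => B / 2)); [apply Derive_const|].
  apply (filter_imp (in_itv a b)); [|exact (locally_in_itv a b s Hs)].
  intros t Ht.
  pose proof (is_derive_inner_self g t _ (smooth_on_is_velocity a b g t Hg Ht)) as H1.
  apply is_derive_unique in H1.
  rewrite (Derive_ext_loc _ (fun u => A + B * u)) in H1.
  - rewrite (is_derive_unique _ _ B) in H1; [lra|].
    auto_derive; [exact I | ring].
  - apply (filter_imp (in_itv a b)); [exact HN | exact (locally_in_itv a b t Ht)].
Qed.

(** Two successive integrations: [<g, g'>] has zero derivative, hence equals a constant [k], and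
    then so does [|g|^2 - 2 k s]. *)
Lemma incompressible_affine_norm (a b : Rbar) (g : R -> plane) :
  Rbar_lt a b -> smooth_on a b g -> unit_speed_on a b g ->
  incompressible_on a b g (canonical_field g) ->
  exists k m : R, forall s, in_itv a b s ->
    inner (g s) (velocity g s) = k /\ inner (g s) (g s) = 2 * k * s + m.
Proof.
  intros Hab Hg Hu Hi. destruct (in_itv_nonempty a b Hab) as [s0 Hs0].
  set (k := inner (g s0) (velocity g s0)).
  assert (Hk : forall s, in_itv a b s -> inner (g s) (velocity g s) = k).
  { intros s Hs.
    apply (constant_on_itv a b (fun t => inner (g t) (velocity g t)));
      try assumption.
    intros t Ht. rewrite <- (Hi t Ht), (divergence_canonical_field a b g t Hu Ht).
    apply Derive_correct, (ex_derive_inner_velocity a b); assumption. }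
  exists k, (inner (g s0) (g s0) - 2 * k * s0). intros s Hs. split; [exact (Hk s Hs)|].
  enough (inner (g s) (g s) - 2 * k * s = inner (g s0) (g s0) - 2 * k * s0) by lra.
  apply (constant_on_itv a b (fun t => inner (g t) (g t) - 2 * k * t));
    try assumption.
  intros t Ht.
  pose proof (is_derive_inner_self g t _ (smooth_on_is_velocity a b g t Hg Ht)) as H1.
  rewrite (Hk t Ht) in H1.
  replace 0 with (minus (2 * k) (2 * k)) by (unfold minus, plus, opp; simpl; ring).
  apply (is_derive_minus (V := R_NormedModule)); [exact H1|].
  auto_derive; [exact I | ring].
Qed.

(** * Nonvanishing of the cross product *)

(** Lagrange's identity in the plane. *)
Lemma cross_square (p v : plane) :
  inner v v = 1 -> cross p v * cross p v = inner p p - inner p v * inner p v.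
Proof.
  intros Hv. transitivity (inner p p * inner v v - inner p v * inner p v).
  - unfold inner, cross; ring.
  - rewrite Hv; ring.
Qed.

Lemma ex_derive_cross_velocity (a b : Rbar) (g : R -> plane) (s : R) :
  smooth_on a b g -> in_itv a b s ->
  ex_derive (fun t => cross (g t) (velocity g t)) s.
Proof.
  intros Hg Hs. destruct (Hg 1%nat s Hs) as [H1 H2].
  destruct (Hg 2%nat s Hs) as [H3 H4].
  unfold cross, velocity.
  apply (ex_derive_minus (V := R_NormedModule)); apply ex_derive_mult; assumption.
Qed.

(** An affine function of nonzero slope changes sign at an interior zero, which a square cannot
    do. *)
Lemma square_affine_neq_0 (a b : Rbar) (h : R -> R) (A B : R) :
  A <> 0 -> (forall s, in_itv a b s -> h s * h s = A * s + B) ->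
  forall s, in_itv a b s -> h s <> 0.
Proof.
  intros HA Hh s Hs H0. pose proof (Hh s Hs) as Hhs. rewrite H0 in Hhs.
  destruct (locally_in_itv a b s Hs) as [[d Hd] Hloc].
  (* At a zero [s] of [h] the hypothesis reads [h (s + e)^2 = A e]; taking [e] of both signs then
     forces [A = 0]. *)
  assert (Hin : forall e, Rabs e < d -> 0 <= A * e).
  { intros e He.
    assert (Ht : in_itv a b (s + e)).
    { apply Hloc. unfold ball; simpl; unfold AbsRing_ball, abs, minus, plus, opp; simpl.
      now replace (s + e + - s) with e by ring. }
    pose proof (Hh _ Ht). nra. }
  pose proof (Hin (d / 2) ltac:(rewrite Rabs_right; lra)) as H1.
  pose proof (Hin (- (d / 2)) ltac:(rewrite Rabs_left; lra)) as H2.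
  assert (A * d = 0) by lra. nra.
Qed.

Lemma eq_of_same_sign_square (sigma x y : R) :
  0 < sigma * x -> 0 < sigma * y -> x * x = y * y -> x = y.
Proof.
  intros Hx Hy Hxy. assert ((x - y) * (x + y) = 0) as H by lra.
  destruct (Rmult_integral _ _ H) as [H1 | H1]; [lra|].
  assert (y = - x) by lra. subst y. lra.
Qed.

(** * Classification of curves with incompressible canonical field *)

Lemma incompressible_portion (a b : Rbar) (g : R -> plane) :
  Rbar_lt a b -> smooth_on a b g -> unit_speed_on a b g ->
  incompressible_on a b g (canonical_field g) ->
  exists theta : R,
    portion_of_centered_circle a b (fun s => rotation theta (g s)) \/
    portion_of_spiral a b (fun s => rotation theta (g s)).
Proof.
  intros Hab Hg Hu Hi.
  destruct (incompressible_affine_norm a b g Hab Hg Hu Hi) as [k [m Hkm]].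
  set (h := fun s => cross (g s) (velocity g s)).
  assert (Hh : forall s, in_itv a b s -> h s * h s = 2 * k * s + (m - k * k)).
  { intros s Hs. unfold h. destruct (Hkm s Hs) as [Hk HN].
    rewrite (cross_square _ _ (unit_speed_inner a b g s Hu Hs)), Hk, HN. ring. }
  assert (Hv : forall s, in_itv a b s -> is_velocity g s (velocity g s))
    by (intros s Hs; exact (smooth_on_is_velocity a b g s Hg Hs)).
  assert (Hn : forall s, in_itv a b s -> h s <> 0).
  { destruct (Req_dec k 0) as [Hk0 | Hk0].
    - intros s Hs Hhs. pose proof (Hh s Hs) as E.
      rewrite Hhs, Hk0 in E. assert (Hm : m = 0) by lra.
      assert (Hg0 : forall t, in_itv a b t -> inner (g t) (g t) = 0).
      { intros t Ht. rewrite (proj2 (Hkm t Ht)), Hk0, Hm. ring. }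
      (* If [k = 0] and [h] vanishes once, then [m = 0] and the curve stays at the origin,
         contradicting unit speed. *)
      assert (Hz : forall t, in_itv a b t -> fst (g t) = 0 /\ snd (g t) = 0).
      { intros t Ht. specialize (Hg0 t Ht). unfold inner in Hg0. split; nra. }
      pose proof (unit_speed_inner a b g s Hu Hs) as H1.
      unfold inner, velocity in H1; simpl in H1.
      rewrite (Derive_ext_loc (fun t => fst (g t)) (fun _ => 0)),
        (Derive_ext_loc (fun t => snd (g t)) (fun _ => 0)), Derive_const in H1.
      + lra.
      + apply (filter_imp (in_itv a b)); [|exact (locally_in_itv a b s Hs)].
        intros t Ht; apply Hz, Ht.
      + apply (filter_imp (in_itv a b)); [|exact (locally_in_itv a b s Hs)].
        intros t Ht; apply Hz, Ht.
    - apply (square_affine_neq_0 a b h (2 * k) (m - k * k)); [lra | exact Hh]. }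
  assert (HN0 : forall s, in_itv a b s -> inner (g s) (g s) <> 0).
  { intros s Hs. rewrite (proj2 (Hkm s Hs)).
    pose proof (Hh s Hs). pose proof (Hn s Hs).
    assert (0 < h s * h s) by nra. nra. }
  destruct (constant_sign_on_itv a b h Hab) as [sigma [Hsigma Hpos]].
  { intros s Hs. apply (ex_derive_continuous (V := R_NormedModule)).
    apply (ex_derive_cross_velocity a b); assumption. }
  { exact Hn. }
  destruct (Req_dec k 0) as [Hk0 | Hk0].
  - destruct (in_itv_nonempty a b Hab) as [s0 Hs0].
    assert (Hm : 0 < m).
    { pose proof (Hh s0 Hs0). pose proof (Hn s0 Hs0). subst k. nra. }
    (* For [k = 0] the squared norm is the constant [m], so the radius is its root; [sigma] is the
       sense in which the circle is traversed. *)
    set (r := sqrt m).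
    assert (Hr : 0 < r) by (apply sqrt_lt_R0; exact Hm).
    assert (Hrr : r * r = m) by (apply sqrt_sqrt; lra).
    destruct (equal_up_to_rotation a b g (fun s => circle r (sigma * s))
      (velocity g)
      (fun s => smul sigma (- sin (sigma * s / r), cos (sigma * s / r))) Hab Hv)
      as [theta Htheta].
    + intros s Hs; apply is_velocity_circle; lra.
    + exact HN0.
    + intros s Hs. rewrite (proj2 (Hkm s Hs)), Hk0, <- Hrr.
      unfold inner, circle; simpl.
      generalize (sin2_cos2 (sigma * s / r)); unfold Rsqr; nra.
    + intros s Hs. rewrite (proj1 (Hkm s Hs)), Hk0.
      unfold inner, circle, smul; simpl. ring.
    + intros s Hs. apply (eq_of_same_sign_square sigma).
      * exact (Hpos s Hs).
      * unfold cross, circle, smul; simpl.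
        generalize (sin2_cos2 (sigma * s / r)); unfold Rsqr; intros E.
        match goal with |- 0 < ?l =>
          replace l with (sigma * sigma * r *
            (sin (sigma * s / r) * sin (sigma * s / r) +
             cos (sigma * s / r) * cos (sigma * s / r))) by ring end.
        rewrite E. destruct Hsigma; subst sigma; lra.
      * change (cross (g s) (velocity g s)) with (h s).
        rewrite (Hh s Hs). unfold cross, circle, smul; simpl.
        generalize (sin2_cos2 (sigma * s / r)); unfold Rsqr; intros E.
        match goal with |- _ = ?l * _ =>
          replace l with (sigma * r *
            (sin (sigma * s / r) * sin (sigma * s / r) +
             cos (sigma * s / r) * cos (sigma * s / r))) by ring end.
        rewrite E, Hk0, <- Hrr. destruct Hsigma; subst sigma; ring.
    + exists theta. left. exists r. split; [exact Hr|].
      exists m_infty, p_infty, (circle r).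
      split; [exact (circle_parametrization r Hr)|].
      exists sigma, 0. split; [exact Hsigma|]. intros s Hs.
      split; [split; exact I|]. rewrite Rplus_0_r. exact (Htheta s Hs).
  (* The spiral has positive inner product with its velocity, so the parameter is reversed exactly
     when [k < 0]. *)
  - assert (Heps : exists eps, (eps = 1 \/ eps = -1) /\ 0 < eps * k).
    { destruct (Rlt_dec 0 k); [exists 1 | exists (-1)]; split; try tauto; lra. }
    destruct Heps as [eps [Heps Hek]].
    assert (Hee : eps * eps = 1) by (destruct Heps; subst eps; ring).
    assert (Hss : sigma * sigma = 1) by (destruct Hsigma; subst sigma; ring).
    (* [c] is determined by matching [2 / c^2 = |k|] and the sign of the cross
       product, the shift by matching the squared norms. *)
    set (w := sqrt (2 / (eps * k))).
    assert (Hw : 0 < w) by (apply sqrt_lt_R0; apply Rdiv_lt_0_compat; lra).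
    assert (Hww : w * w = 2 / (eps * k))
      by (apply sqrt_sqrt; apply Rlt_le, Rdiv_lt_0_compat; lra).
    set (c := eps * sigma * w).
    assert (Hcc : c ^ 2 = 2 / (eps * k)).
    { transitivity ((eps * eps) * (sigma * sigma) * (w * w)); [unfold c; ring|].
      rewrite Hee, Hss, Hww; ring. }
    assert (Hc : c <> 0).
    { intros E. rewrite E in Hcc.
      assert (0 < 2 / (eps * k)) by (apply Rdiv_lt_0_compat; lra). lra. }
    set (s0 := (m - k * k) / (2 * (eps * k))).
    assert (Hek0 : eps <> 0 /\ k <> 0) by (split; [nra | exact Hk0]).
    (* In the shifted parameter [h^2] is a positive multiple of [eps * s + s0], so its positivity
       puts that parameter in the domain of the spiral. *)
    assert (Ht : forall s, in_itv a b s ->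
      h s * h s = 2 * (eps * k) * (eps * s + s0)).
    { intros s Hs. rewrite (Hh s Hs).
      transitivity (2 * (eps * eps) * k * s + (m - k * k)); [rewrite Hee; ring|].
      unfold s0; field; tauto. }
    assert (Htpos : forall s, in_itv a b s -> 0 < eps * s + s0).
    { intros s Hs. pose proof (Ht s Hs). pose proof (Hn s Hs).
      assert (0 < h s * h s) by nra.
      apply (Rmult_lt_reg_l (2 * (eps * k))); lra. }
    assert (Hcross : forall s, cross (spiral c (eps * s + s0))
        (smul eps (cos (c * sqrt (eps * s + s0)), sin (c * sqrt (eps * s + s0))))
        = eps * (2 / c * sqrt (eps * s + s0))).
    { intros s. rewrite <- (proj2 (spiral_inner_velocity c _ Hc)).
      unfold cross, smul; cbn [fst snd]; ring. }
    destruct (equal_up_to_rotation a b g (fun s => spiral c (eps * s + s0))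
      (velocity g)
      (fun s => smul eps (cos (c * sqrt (eps * s + s0)),
                          sin (c * sqrt (eps * s + s0)))) Hab Hv)
      as [theta Htheta].
    + intros s Hs; apply is_velocity_spiral; [exact Hc | exact (Htpos s Hs)].
    + exact HN0.
    + intros s Hs. rewrite (inner_spiral c _ Hc) by (apply Rlt_le, Htpos, Hs).
      replace (c ^ 4) with (c ^ 2 * c ^ 2) by ring. rewrite Hcc.
      rewrite (proj2 (Hkm s Hs)).
      (* Both sides are compared with [k^2 + h^2]. *)
      transitivity ((eps * eps) * k * k + 2 * (eps * k) * (eps * s + s0)).
      * rewrite <- (Ht s Hs), (Hh s Hs), Hee; ring.
      * field; tauto.
    + intros s Hs. rewrite (proj1 (Hkm s Hs)).
      transitivity (eps * (2 / c ^ 2)).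
      * rewrite Hcc. transitivity (eps * eps * k); [rewrite Hee; ring | field; tauto].
      * rewrite <- (proj1 (spiral_inner_velocity c (eps * s + s0) Hc)).
        unfold inner, smul; cbn [fst snd]; ring.
    + intros s Hs. apply (eq_of_same_sign_square sigma).
      * exact (Hpos s Hs).
      * rewrite Hcross. pose proof (sqrt_lt_R0 _ (Htpos s Hs)) as Hq.
        (* By the choice of sign in [c], the factor [sigma * eps / c] is [1 / w], which is
           positive. *)
        replace (sigma * (eps * (2 / c * sqrt (eps * s + s0))))
          with (2 * sqrt (eps * s + s0) / w);
          [apply Rdiv_lt_0_compat; lra|].
        unfold c; field. repeat split; try lra; nra.
      * rewrite Hcross. change (cross (g s) (velocity g s)) with (h s).
        rewrite (Ht s Hs).
        transitivity (eps * eps * (4 / c ^ 2) *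
          (sqrt (eps * s + s0) * sqrt (eps * s + s0))); [|field; exact Hc].
        rewrite sqrt_sqrt by (apply Rlt_le, Htpos, Hs).
        rewrite Hcc, Hee. field; tauto.
    + exists theta. right. exists c. split; [exact Hc|].
      exists eps, s0. split; [exact Heps|]. intros s Hs.
      split; [split; [exact (Htpos s Hs) | exact I] | exact (Htheta s Hs)].
Qed.

(** * The equivalence, with the converse obtained from affine squared norms *)

Theorem theorem4p1 :
  forall (a b : Rbar) (gamma : R -> plane),
    Rbar_lt a b ->
    smooth_on a b gamma ->
    unit_speed_on a b gamma ->
    (incompressible_on a b gamma (canonical_field gamma) <->
     exists theta : R,
       portion_of_centered_circle a b (fun s => rotation theta (gamma s)) \/
       portion_of_spiral a b (fun s => rotation theta (gamma s))).
Proof.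
  intros a b gamma Hab Hg Hu. split.
  - exact (incompressible_portion a b gamma Hab Hg Hu).
  - intros [theta [[r [Hr [a' [b' [h [[_ [_ [_ Hh]]] [eps [s0 [_ Hp]]]]]]]]]
                  | [c [Hc [eps [s0 [_ Hp]]]]]]].
    (* Rotations preserve the norm, so on a circle the squared norm is the constant [r * r], affine
       with slope 0. *)
    + apply (incompressible_of_affine_norm a b gamma (r * r) 0 Hg Hu).
      intros s Hs. destruct (Hp s Hs) as [Hin Heq].
      rewrite <- (inner_rotation theta), Heq, Rmult_0_l, Rplus_0_r.
      apply enorm_eq_iff; [lra|]. apply Hh. now exists (eps * s + s0).
    (* The coefficients come from expanding the squared norm of the spiral at [eps * s + s0]. *)
    + apply (incompressible_of_affine_norm a b gamma
               (4 / c ^ 4 + 4 / c ^ 2 * s0) (4 / c ^ 2 * eps) Hg Hu).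
      intros s Hs. destruct (Hp s Hs) as [[Hin _] Heq]. simpl in Hin.
      rewrite <- (inner_rotation theta), Heq, inner_spiral by (exact Hc || lra).
      ring.
Qed.
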